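(* Let $C\ge2$. For a matrix $\boldsymbol{M}=[\boldsymbol{\mu}_1,\dots,\boldsymbol{\mu}_C]\in\mathbb{R}^{C\times C}$, a matrix $\boldsymbol{W}\in\mathbb{R}^{C\times C}$ with rows $\boldsymbol{w}_c^\top$ and a vector $\boldsymbol{b}\in\mathbb{R}^C$, consider the observation $\boldsymbol{h}=\boldsymbol{\mu}_\gamma+\boldsymbol{z}$, where $\gamma\sim\mathrm{Unif}\{1,\dots,C\}$ and $\boldsymbol{z}\sim\mathcal{N}(\mathbf{0},\sigma^2\boldsymbol{I}_C)$ are independent, the decision rule $\hat\gamma(\boldsymbol{h})=\arg\max_c\langle\boldsymbol{w}_c,\boldsymbol{h}\rangle+b_c$, and the error exponent $\beta(\boldsymbol{M},\boldsymbol{W},\boldsymbol{b})=-\lim_{\sigma\to0}\sigma^2\log P_\sigma\{\hat\gamma(\boldsymbol{h})\ne\gamma\}$. Then $$\beta^\star:=\max_{\boldsymbol{M},\boldsymbol{W},\boldsymbol{b}}\beta(\boldsymbol{M},\boldsymbol{W},\boldsymbol{b})\ \text{ s.t. }\ \|\boldsymbol{\mu}_c\|_2\le1\ \forall c\quad\text{equals}\quad \frac{C}{C-1}\cdot\frac14.$$ Moreover, with $\boldsymbol{M}^\star=\sqrt{\frac{C}{C-1}}\left(\boldsymbol{I}-\frac1C\mathbf{1}\mathbf{1}^\top\right)$, one has $\beta(\boldsymbol{M}^\star,\boldsymbol{M}^\star,\mathbf{0})=\beta^\star$. Every $\boldsymbol{M}$ with columns of norm at most $1$ for which some $\boldsymbol{W},\boldsymbol{b}$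 achieve $\beta(\boldsymbol{M},\boldsymbol{W},\boldsymbol{b})=\beta^\star$ is of the form $\boldsymbol{M}=\boldsymbol{U}\boldsymbol{M}^\star$ for some orthogonal $\boldsymbol{U}\in\mathbb{R}^{C\times C}$, and for such $\boldsymbol{M}$ the choice $\boldsymbol{W}=\boldsymbol{M}^\star\boldsymbol{U}^\top$, $\boldsymbol{b}=\mathbf{0}$ satisfies $\beta(\boldsymbol{M},\boldsymbol{W},\boldsymbol{b})=\beta^\star$.
   Context: $\mathbf{1}$ is the all-ones vector in $\mathbb{R}^C$; $\boldsymbol{M}^\star$ is the standard simplex equiangular tight frame. The maximum is over all $C\times C$ matrices $\boldsymbol{M}$ with columns of Euclidean norm at most $1$, all $C\times C$ matrices $\boldsymbol{W}$ and all $\boldsymbol{b}\in\mathbb{R}^C$. *)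

(* Defs.v *)
From HB Require Import structures.
From mathcomp Require Import all_boot all_order all_algebra.
From mathcomp Require Import all_classical all_reals all_analysis.
Set Implicit Arguments. Unset Strict Implicit. Unset Printing Implicit Defensive.
Import Order.TTheory GRing.Theory Num.Theory.
Import numFieldNormedType.Exports.
Local Open Scope classical_set_scope.
Local Open Scope ring_scope.

(* Z : 'I_C -> (T -> R) is a vector of i.i.d. standard normal random variables
   on the probability space (T, P): each coordinate is measurable with law
   N(0,1), and the coordinates are mutually independent (product rule; taking
   some A i = setT gives the product rule for every subfamily). *)
Definition iid_std_gaussian (R : realType) (d : measure_display)
  (T : measurableType d) (P : probability T R) (C : nat)
  (Z : 'I_C -> T -> R) : Prop :=
  (forall i, measurable_fun setT (Z i)) /\
  (forall i (A : set R), measurable A ->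
      P ((Z i) @^-1` A) = normal_prob 0 1 A) /\
  (forall A : 'I_C -> set R, (forall i, measurable (A i)) ->
      P (\bigcap_(i in [set: 'I_C]) (Z i) @^-1` (A i))
      = (\prod_(i < C) P ((Z i) @^-1` (A i)))%E).

Definition colnorm2 (R : realType) C (M : 'M[R]_C) (c : 'I_C) : R :=
  \sum_(i < C) (M i c) ^+ 2.

Definition score (R : realType) C (W : 'M[R]_C) (b : 'cV[R]_C)
  (h : 'cV[R]_C) (c : 'I_C) : R := \sum_(j < C) W c j * h j ord0 + b c ord0.

(* Misclassification event for true class g, noise level s, noise sample t:
   h = mu_g + s * Z(t); the argmax decision is wrong iff g is not the unique
   maximiser of the scores (ties are counted as errors). *)
Definition misclassified (R : realType) (d : measure_display)
  (T : measurableType d) C (Z : 'I_C -> T -> R)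
  (M W : 'M[R]_C) (b : 'cV[R]_C) (s : R) (g : 'I_C) : set T :=
  [set t | exists2 c : 'I_C, c != g &
     score W b (col g M + s *: \col_i Z i t) g
       <= score W b (col g M + s *: \col_i Z i t) c].

(* P_sigma{ hat gamma(h) <> gamma } with gamma ~ Unif{1..C} independent of z. *)
Definition error_prob (R : realType) (d : measure_display)
  (T : measurableType d) (P : probability T R) C (Z : 'I_C -> T -> R)
  (M W : 'M[R]_C) (b : 'cV[R]_C) (s : R) : R :=
  (C%:R)^-1 * \sum_(g < C) fine (P (misclassified Z M W b s g)).

Definition has_error_exponent (R : realType) (d : measure_display)
  (T : measurableType d) (P : probability T R) C (Z : 'I_C -> T -> R)
  (M W : 'M[R]_C) (b : 'cV[R]_C) (beta : R) : Prop :=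
  (fun s : R => - (s ^+ 2 * ln (error_prob P Z M W b s))) @ (0:R)^'+ --> beta.

Definition orthogonal_mx (R : realType) C (U : 'M[R]_C) : Prop :=
  U^T *m U = 1%:M.

Definition simplex_ETF (R : realType) (C : nat) : 'M[R]_C :=
  Num.sqrt (C%:R / (C%:R - 1)) *: (1%:M - (C%:R)^-1 *: const_mx 1).

Definition beta_star (R : realType) (C : nat) : R :=
  C%:R / (C%:R - 1) * 4^-1.

(* Main.v *)
Require Import Defs.
From HB Require Import structures.
From mathcomp Require Import all_boot all_order all_algebra.
From mathcomp Require Import all_classical all_reals all_analysis.
From mathcomp Require Import measurable_realfun ring lra.
Import Order.TTheory GRing.Theory Num.Theory.
Import numFieldNormedType.Exports.
Local Open Scope classical_set_scope.
Local Open Scope ring_scope.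

(* For two classes i and j, the midpoint of mu_i and mu_j is misclassified for
   one of them, so that class errs on a half-space at distance at most
   |mu_i - mu_j| / (2 sigma) from the origin of the noise.  Hence every error
   exponent is at most |mu_i - mu_j|^2 / 8 for all pairs.  Since the squared
   distances of the C columns sum up to at most 2 C^2, their minimum is at most
   2 C / (C - 1), with equality only when the Gram matrix is that of the regular
   simplex, which determines M up to an isometry.  Conversely, for the simplex
   with matched filter W = M^T, the union bound and Chernoff's bound on each of
   the half-spaces give the same exponent. *)

(** * Integrals against Gaussian product laws *)

Section weighted_pushforward.
Local Open Scope ereal_scope.
Context (d d' : measure_display) (T : measurableType d) (Y : measurableType d')
  (R : realType).
Variables (m : {measure set T -> \bar R}) (nu : {measure set Y -> \bar R}).
Variables (X : T -> Y) (h : T -> R) (c : R).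
Hypotheses (mX : measurable_fun setT X) (mh : measurable_fun setT h).
Hypotheses (h0 : forall t, (0 <= h t)%R) (c0 : (0 <= c)%R).
Hypothesis hE : forall A, measurable A ->
  \int[m]_t (h t * \1_A (X t))%:E = c%:E * nu A.

Import HBNNSimple.

(** A simple function is a finite combination of indicators of its level sets, so [hE] extends to it
    by linearity. *)
Lemma weighted_pushforward_nnsfun (f : {nnsfun Y >-> R}) :
  \int[m]_t (h t * f (X t))%:E = c%:E * \int[nu]_y (f y)%:E.
Proof.
transitivity (\int[m]_t
    \sum_(r \in range f) (r%:E * (h t * \1_(f @^-1` [set r]) (X t))%:E)).
  apply: eq_integral => t _; rewrite [in LHS]fimfunE.
  rewrite EFinM -fsumEFin// ge0_mule_fsumr; last first.
    by move=> r; rewrite EFinM nnfun_muleindic_ge0.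
  by apply: eq_fsbigr => r _; rewrite -!EFinM mulrCA.
have mhA r : measurable_fun setT
    ((fun t => (h t * \1_(f @^-1` [set r]) (X t))%:E) : T -> \bar R).
  apply/measurable_EFinP/measurable_funM => //.
  exact: measurableT_comp.
rewrite ge0_integral_fsum//; last 2 first.
  - by move=> r; apply: measurable_funeM.
  - move=> r t _; rewrite -EFinM mulrCA EFinM mule_ge0 ?lee_fin//.
    by have := nnfun_muleindic_ge0 f r (X t); rewrite -EFinM lee_fin.
transitivity (\int[nu]_y (c%:E * (f y)%:E)); last first.
  rewrite ge0_integralZl//=; first exact/measurable_EFinP.
  by move=> y _; rewrite lee_fin.
under [RHS]eq_integral.
  move=> y _; rewrite fimfunE -fsumEFin// ge0_mule_fsumr; last first.
    by move=> r; rewrite EFinM nnfun_muleindic_ge0.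
  over.
rewrite [RHS]ge0_integral_fsum//; last 2 first.
  - by move=> r; apply/measurable_EFinP; do 2 apply/measurableT_comp => //.
  - by move=> n x _; rewrite EFinM mule_ge0// nnfun_muleindic_ge0.
apply: eq_fsbigr => r rf.
have r0 : (0 <= r)%R by move: rf; rewrite inE => -[y _ <-].
rewrite ge0_integralZl//; last by move=> t _; rewrite lee_fin mulr_ge0.
rewrite hE// ge0_integralZl//; last 2 first.
- exact/measurable_EFinP/measurableT_comp.
- by move=> t _; rewrite nnfun_muleindic_ge0.
by rewrite integralZl_indic_nnsfun//= integral_indic// setIT muleCA.
Qed.

(* With [X = idfun] this integrates against a density; with [h] a function of
   the remaining coordinates it expresses independence of [X] from them. *)
Lemma weighted_pushforward (f : Y -> R) : measurable_fun setT f ->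
  (forall y, (0 <= f y)%R) ->
  \int[m]_t (h t * f (X t))%:E = c%:E * \int[nu]_y (f y)%:E.
Proof.
move=> mf f0.
have mf' : measurable_fun setT (EFin \o f) by exact/measurable_EFinP.
have f0' y : setT y -> 0 <= (EFin \o f) y by rewrite lee_fin.
pose f_ := nnsfun_approx measurableT mf'.
(* Monotone convergence is applied on both sides along the simple functions [f_ n] increasing to
   [f]. *)
transitivity (limn (fun n => \int[m]_t (h t * f_ n (X t))%:E)).
  rewrite -monotone_convergence//=.
  - apply: eq_integral => t _; apply/esym/cvg_lim => //.
    under eq_fun do rewrite EFinM.
    rewrite EFinM; apply: cvgeM => //; last first.
      exact: (@cvg_nnsfun_approx _ _ _ _ measurableT _ mf' f0' (X t) I).
    + exact: cvg_cst.
  - move=> n; apply/measurable_EFinP/measurable_funM => //.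
    exact: measurableT_comp.
  - by move=> n x _; rewrite lee_fin mulr_ge0.
  - move=> x _ a b ab; rewrite lee_fin ler_wpM2l//.
    exact/lefP/nd_nnsfun_approx.
under eq_fun do rewrite weighted_pushforward_nnsfun.
apply/cvg_lim => //; apply: cvgeZl => //.
have -> : \int[nu]_y (f y)%:E = limn (fun n => \int[nu]_y (f_ n y)%:E).
  rewrite -monotone_convergence//=.
  - apply: eq_integral => x _; apply/esym/cvg_lim => //.
    exact: (@cvg_nnsfun_approx _ _ _ _ measurableT _ mf' f0' x I).
  - by move=> n; exact/measurable_EFinP.
  - by move=> n x _; rewrite lee_fin.
  - by move=> x _ a b ab; rewrite lee_fin//; exact/lefP/nd_nnsfun_approx.
apply/ereal_nondecreasing_is_cvgn => a b ab; apply: ge0_le_integral => //.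
- by move=> x _; rewrite lee_fin.
- exact/measurable_EFinP.
- exact/measurable_EFinP.
- by move=> x _; rewrite lee_fin; exact/lefP/nd_nnsfun_approx.
Qed.

End weighted_pushforward.

Lemma integral_normal_prob (R : realType) (mean dev : R) (f : R -> R) :
  measurable_fun setT f -> (forall x, 0 <= f x) ->
  (\int[normal_prob mean dev]_x (f x)%:E =
   \int[lebesgue_measure]_x (normal_pdf mean dev x * f x)%:E)%E.
Proof.
move=> mf f0.
rewrite -[LHS]mul1e; apply/esym.
apply: (@weighted_pushforward _ _ _ _ _ lebesgue_measure
  (normal_prob mean dev) idfun (normal_pdf mean dev) 1) => //.
- exact: measurable_id.
- exact: measurable_normal_pdf.
- exact: normal_pdf_ge0.
- move=> A mA; rewrite mul1e /normal_prob [RHS]integral_mkcond.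
  apply: eq_integral => x _; rewrite patchE indicE/=.
  by case: ifP; rewrite ?mulr1 ?mulr0.
Qed.

Lemma integral_normal_prob_indic (R : realType) (mean dev : R) (A : set R) :
  measurable A ->
  (\int[normal_prob mean dev]_x (\1_A x)%:E = normal_prob mean dev A)%E.
Proof. by move=> mA; rewrite (integral_indic _ measurableT)// setIT. Qed.

(** Completing the square turns the tilted standard density into [expR (c ^+ 2 / 2)] times the
    normal density of mean [c], whose integral is one. *)
Lemma normal_prob_mgf (R : realType) (c : R) :
  (\int[normal_prob 0 1]_x (expR (c * x))%:E = (expR (c ^+ 2 / 2))%:E)%E.
Proof.
rewrite integral_normal_prob; last 2 first.
- by apply: measurableT_comp => //; exact: measurable_funM.
- by move=> x; exact: expR_ge0.
transitivity (\int[lebesgue_measure]_x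
    ((expR (c ^+ 2 / 2))%:E * (normal_pdf c 1 x)%:E)%E)%E.
  apply: eq_integral => x _; rewrite -EFinM !normal_pdfE ?oner_eq0//.
  rewrite /normal_fun mulrCA -!mulrA -!expRD; congr (_ * expR _)%:E.
  by rewrite subr0 expr1n; field.
rewrite ge0_integralZl//; last 2 first.
- by apply/measurable_EFinP; exact: measurable_normal_pdf.
- by move=> x _; rewrite lee_fin normal_pdf_ge0.
by rewrite integral_normal_pdf mule1.
Qed.

(** * Product moments and tails of an independent Gaussian vector *)

Section gaussian_vector.
Context (R : realType) (d : measure_display) (T : measurableType d)
  (P : probability T R) (C : nat) (Z : 'I_C -> T -> R).
Hypothesis hZ : iid_std_gaussian P Z.

Let mZ i : measurable_fun setT (Z i). Proof. by case: hZ. Qed.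

Let PZ i (A : set R) : measurable A -> P (Z i @^-1` A) = normal_prob 0 1 A.
Proof. by case: hZ => _ [+ _]; apply. Qed.

Lemma iid_gaussian_bigcap (A : 'I_C -> set R) : (forall i, measurable (A i)) ->
  P (\bigcap_(i in [set: 'I_C]) Z i @^-1` A i) =
  (\prod_(i < C) normal_prob 0 1 (A i))%E.
Proof.
case: hZ => _ [_ indZ] mA; rewrite indZ//.
by apply: eq_bigr => i _; rewrite PZ.
Qed.

(** Independence is given for events only; this extends it to nonnegative functions, as needed for
    exponential moments. *)
Lemma iid_gaussian_integral_prod (g : 'I_C -> R -> R) (e : 'I_C -> R) :
  (forall i, measurable_fun setT (g i)) -> (forall i x, 0 <= g i x) ->
  (forall i, \int[normal_prob 0 1]_x (g i x)%:E = (e i)%:E)%E ->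
  (\int[P]_t (\prod_(i < C) g i (Z i t))%:E = (\prod_(i < C) e i)%:E)%E.
Proof.
(* Indicators are traded for general functions one coordinate at a time. *)
suff H (k : nat) : forall (g : 'I_C -> R -> R) (e : 'I_C -> R),
    (forall i, measurable_fun setT (g i)) ->
    (forall i x, 0 <= g i x) ->
    (forall i, \int[normal_prob 0 1]_x (g i x)%:E = (e i)%:E)%E ->
    (forall i : 'I_C, (k <= i)%N -> exists2 A, measurable A & g i = \1_A) ->
    (\int[P]_t (\prod_(i < C) g i (Z i t))%:E = (\prod_(i < C) e i)%:E)%E.
  move=> mg g0 ge; apply: (H C) => // i.
  by rewrite leqNgt ltn_ord.
elim: k => [|k IH] {}g {}e mg g0 ge gA.
  (* For [k = 0] every factor is an indicator; their product is the indicator of an intersection,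
     and the product rule applies. *)
  have /choice [A AP] : forall i, exists A : set R, measurable A /\ g i = \1_A.
    by move=> i; have [A] := gA i isT; exists A.
  have mA i : measurable (A i) by case: (AP i).
  transitivity (\int[P]_t
      (\1_(\bigcap_(i in [set: 'I_C]) Z i @^-1` A i) t)%:E)%E.
    apply: eq_integral => t _; congr EFin.
    under eq_bigr => i _ do rewrite (AP i).2 indicE.
    rewrite indicE; case: (boolP (t \in _)) => [|].
      rewrite inE => tA; rewrite big1// => i _.
      by rewrite mem_set//; exact: tA.
    rewrite notin_setE => /existsNP [i] /not_implyP [_ nA].
    by rewrite (bigD1 i)//= memNset// mul0r.
  have mI : measurable (\bigcap_(i in [set: 'I_C]) Z i @^-1` A i).
    apply: fin_bigcap_measurable => // i _.
    by rewrite -[_ @^-1` _]setTI; exact: mZ.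
  rewrite integral_indic// setIT -prodEFin.
  apply: etrans; first exact: (iid_gaussian_bigcap _ mA).
  apply: eq_bigr => i _; rewrite -ge (AP i).2.
  by rewrite integral_normal_prob_indic.
have [Ck|kC] := leqP C k.
  by apply: IH => // i ki; have := ltn_ord i; rewrite ltnNge (leq_trans Ck ki).
pose i0 := Ordinal kC.
have e0 i : 0 <= e i.
  by rewrite -lee_fin -ge integral_ge0// => x _; rewrite lee_fin.
rewrite [in RHS](bigD1 i0)//= mulrC EFinM -ge.
under eq_integral do rewrite (bigD1 i0)//= mulrC.
pose h t := \prod_(i < C | i != i0) g i (Z i t).
have hE : h =
    fun t => \prod_(i <- [seq i <- index_enum 'I_C | i != i0]) g i (Z i t).
  by apply/funext => t; rewrite big_filter.
apply: (@weighted_pushforward _ _ _ _ _ P (normal_prob 0 1) (Z i0) h) => //.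
- exact: mZ.
- by rewrite hE; apply: measurable_prod => i _; exact: measurableT_comp.
- by move=> t; exact: prodr_ge0.
- exact: prodr_ge0.
(* With coordinate [k] replaced by an indicator, all coordinates from [k] on are indicators, so the
   induction hypothesis gives the identity that [weighted_pushforward] requires. *)
move=> A mA.
pose g' i := if i == i0 then \1_A else g i.
pose e' i := if i == i0 then fine (normal_prob 0 1 A) else e i.
have := IH g' e'; rewrite (bigD1 i0)//= {2}/e' eqxx.
rewrite mulrC EFinM fineK ?fin_num_measure//.
rewrite (eq_bigr e); last by move=> i /negbTE; rewrite /e' => ->.
move=> <-.
- apply: eq_integral => t _; rewrite [in RHS](bigD1 i0)//= /g' eqxx mulrC.
  by congr (_ * _)%:E; apply: eq_bigr => i /negbTE ->.
- by rewrite /g' => i; case: ifP => // _; exact: measurable_indic.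
- by rewrite /g' => i x; case: ifP.
- rewrite /g' /e' => i; case: ifP => // _.
  by rewrite integral_normal_prob_indic// fineK ?fin_num_measure.
- rewrite /g' => i ki; case: ifP => [_|/negbT ii0]; first by exists A.
  by apply: gA; rewrite ltn_neqAle ki andbT eq_sym.
- exact: mg.
Qed.

(** Chernoff's bound: Markov's inequality for the exponential of [l] times the linear form, whose
    moment factors over the coordinates. *)
Lemma gaussian_halfspace_le (w : 'I_C -> R) (r : R) : 0 <= r ->
  0 < \sum_(i < C) w i ^+ 2 ->
  (P [set t | r <= \sum_(i < C) w i * Z i t]%R <=
   (expR (- (r ^+ 2 / (2 * \sum_(i < C) w i ^+ 2))))%:E)%E.
Proof.
move=> r0; set n := \sum_(i < C) _ => n0.
(* This [l] minimises the Chernoff exponent [l ^+ 2 * n / 2 - l * r]. *)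
pose l := r / n.
have l0 : 0 <= l by rewrite divr_ge0// ltW.
have mS : measurable_fun setT (fun t => \sum_(i < C) w i * Z i t).
  by apply: measurable_sum => i; exact: measurable_funM.
have mE : measurable [set t | r <= \sum_(i < C) w i * Z i t].
  have -> : [set t | r <= \sum_(i < C) w i * Z i t] =
      (fun t => \sum_(i < C) w i * Z i t) @^-1` `[r, +oo[%classic.
    by apply/seteqP; split => t /=; rewrite in_itv/= andbT.
  by rewrite -[_ @^-1` _]setTI; apply: mS.
have EE : (\int[P]_t (\prod_(i < C) expR (l * w i * Z i t))%:E =
    (\prod_(i < C) expR ((l * w i) ^+ 2 / 2))%:E)%E.
  apply: (iid_gaussian_integral_prod (fun i x => expR (l * w i * x))).
  - by move=> i; apply: measurableT_comp => //; exact: measurable_funM.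
  - by move=> i x; exact: expR_ge0.
  - by move=> i; exact: normal_prob_mgf.
have mprod : measurable_fun setT
    (fun t => \prod_(i < C) expR (l * w i * Z i t)).
  apply: measurable_prod => i _.
  by apply: measurableT_comp => //; exact: measurable_funM.
rewrite -[X in P X]setIT -integral_indic//.
apply: (@le_trans _ _ (\int[P]_t
    ((expR (- (l * r)))%:E * (\prod_(i < C) expR (l * w i * Z i t))%:E))%E).
  apply: ge0_le_integral => //.
  - by apply/measurable_EFinP; exact: measurable_indic.
  - by apply: measurable_funeM; exact/measurable_EFinP.
  - move=> t _; rewrite -EFinM lee_fin indicE -expR_sum -expRD.
    case: (boolP (t \in _)) => [|_]; last exact: expR_ge0.
    rewrite inE/= => rt; rewrite -[leLHS]expR0 ler_expR addrC subr_ge0.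
    under eq_bigr do rewrite -mulrA.
    by rewrite -mulr_sumr ler_wpM2l.
rewrite ge0_integralZl//; last 2 first.
- exact/measurable_EFinP.
- by move=> t _; rewrite lee_fin prodr_ge0// => i _; exact: expR_ge0.
rewrite EE -EFinM lee_fin -expR_sum -expRD ler_expR.
have -> : \sum_(i < C) (l * w i) ^+ 2 / 2 = l ^+ 2 / 2 * n.
  by rewrite /n mulr_sumr; apply: eq_bigr => i _; field.
rewrite le_eqVlt; apply/orP; left; apply/eqP; rewrite /l; field.
by rewrite gt_eqF.
Qed.

End gaussian_vector.

(** * Point configurations of maximal minimum distance *)

Section column_geometry.
Variables (R : realType) (C : nat).
Implicit Types (M U : 'M[R]_C) (i j c : 'I_C).

Definition coldist2 M i j : R := \sum_(k < C) (M k i - M k j) ^+ 2.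

Lemma coldist2E M i j :
  coldist2 M i j = colnorm2 M i + colnorm2 M j - 2 * (M^T *m M) i j.
Proof.
rewrite /coldist2 /colnorm2 mxE mulr_sumr -big_split -sumrB /=.
by apply: eq_bigr => k _; rewrite mxE; ring.
Qed.

Lemma colnorm2_gram M c : colnorm2 M c = (M^T *m M) c c.
Proof. by rewrite mxE; apply: eq_bigr => k _; rewrite mxE expr2. Qed.

(** The Gram entries sum to the squared norm of the sum of all columns, which is the subtracted
    term; it vanishes exactly for centred configurations. *)
Lemma sum_coldist2 M : \sum_i \sum_j coldist2 M i j =
  2 * (C%:R * \sum_i colnorm2 M i - \sum_(k < C) (\sum_i M k i) ^+ 2).
Proof.
have -> : \sum_(k < C) (\sum_i M k i) ^+ 2 = \sum_i \sum_j (M^T *m M) i j.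
  under [RHS]eq_bigr do under eq_bigr do rewrite mxE.
  under [RHS]eq_bigr do rewrite exchange_big/=.
  rewrite exchange_big/=; apply: eq_bigr => k _.
  rewrite expr2 mulr_suml; apply: eq_bigr => i _.
  by rewrite mulr_sumr; apply: eq_bigr => j _; rewrite !mxE.
under eq_bigr do under eq_bigr do rewrite coldist2E.
under eq_bigr do rewrite sumrB big_split sumr_const card_ord -mulr_sumr/=.
rewrite sumrB big_split/= sumr_const card_ord -mulr_sumr sumrMnl.
by rewrite -[_ *+ C]mulr_natl; ring.
Qed.

Hypothesis C2 : (2 <= C)%N.

Let CgtR1 : 1 < C%:R :> R. Proof. by rewrite ltr1n. Qed.

Let a : R := C%:R / (C%:R - 1).

Let a_gt0 : 0 < a. Proof. by apply: divr_gt0; rewrite ?subr_gt0 ?(lt_trans ltr01). Qed.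

Lemma sum_offdiag (x : R) :
  \sum_(i < C) \sum_(j < C) (if i != j then x else 0) = C%:R * (C%:R - 1) * x.
Proof.
transitivity (\sum_(i < C) (C%:R - 1) * x).
  apply: eq_bigr => i _; rewrite -big_mkcond/=.
  rewrite (eq_bigl (predC1 i)); last by move=> j; rewrite /= eq_sym.
  rewrite sumr_const cardC1 card_ord -[_ *+ _]mulr_natl.
  by rewrite -subn1 natrB// (leq_trans _ C2).
by rewrite sumr_const card_ord -[LHS]mulr_natl mulrA.
Qed.

(** The minimum is at most the average over the C(C-1) ordered pairs, and [sum_coldist2] bounds the
    total by 2 C^2 once the squared norm of the column sum is dropped. *)
Lemma coldist2_min_le M (b : R) : (forall c, colnorm2 M c <= 1) ->
  (forall i j, i != j -> b <= coldist2 M i j) -> b <= 2 * a.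
Proof.
move=> M1 Mb.
have H : C%:R * (C%:R - 1) * b <= 2 * (C%:R * C%:R).
  rewrite -sum_offdiag.
  apply: (@le_trans _ _ (\sum_i \sum_j coldist2 M i j)).
    apply: ler_sum => i _; apply: ler_sum => j _.
    by case: ifP => [/Mb //|_]; apply: sumr_ge0 => k _; exact: sqr_ge0.
  rewrite sum_coldist2; apply: ler_wpM2l => //.
  rewrite lerBlDr -[leLHS]addr0; apply: lerD.
    apply: ler_wpM2l => //; rewrite -[leRHS]/(1 *+ C) -[X in _ *+ X]card_ord.
    by rewrite -sumr_const; apply: ler_sum => i _.
  by apply: sumr_ge0 => k _; exact: sqr_ge0.
rewrite /a mulrA ler_pdivlMr ?subr_gt0//.
rewrite -(ler_pM2l (x := C%:R)) ?(lt_trans ltr01)//.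
by move: H; lra.
Qed.

(** This is the equality case of the averaging bound: each inequality used there has a nonnegative
    defect, and all defects must vanish. *)
Lemma coldist2_extremal M : (forall c, colnorm2 M c <= 1) ->
  (forall i j, i != j -> 2 * a <= coldist2 M i j) ->
  [/\ forall k, \sum_i M k i = 0, forall c, colnorm2 M c = 1 &
      forall i j, i != j -> coldist2 M i j = 2 * a].
Proof.
move=> M1 Ma.
pose x i j := coldist2 M i j - (if i != j then 2 * a else 0).
have x0 i j : 0 <= x i j.
  rewrite /x subr_ge0; case: ifP => [/Ma //|_].
  by apply: sumr_ge0 => k _; exact: sqr_ge0.
have y0 i : 0 <= 1 - colnorm2 M i by rewrite subr_ge0.
(* The three defects are the excess of the distances over [2 * a], the shortfall of the norms from
   one, and the squared norm of the column sum; the value of [a] makes their weighted sum zero. *)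
have sx : \sum_i \sum_j x i j + 2 * C%:R * \sum_i (1 - colnorm2 M i)
    + 2 * \sum_(k < C) (\sum_i M k i) ^+ 2 = 0.
  under eq_bigr do rewrite sumrB.
  rewrite sumrB sum_offdiag sum_coldist2 sumrB sumr_const card_ord /a.
  by field; rewrite subr_eq0 gt_eqF.
have sx0 : 0 <= \sum_i \sum_j x i j.
  by apply: sumr_ge0 => i _; apply: sumr_ge0.
have sy0 : 0 <= \sum_i (1 - colnorm2 M i) by exact: sumr_ge0.
have sz0 : 0 <= \sum_(k < C) (\sum_i M k i) ^+ 2.
  by apply: sumr_ge0 => k _; exact: sqr_ge0.
have C0 : 0 < C%:R :> R by exact: lt_trans ltr01 CgtR1.
have sCy0 : 0 <= C%:R * \sum_i (1 - colnorm2 M i).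
  by apply: mulr_ge0 => //; exact: ltW.
have /eqP sxE : \sum_i \sum_j x i j = 0 by lra.
have /eqP syE : C%:R * \sum_i (1 - colnorm2 M i) = 0 by lra.
have /eqP szE : \sum_(k < C) (\sum_i M k i) ^+ 2 = 0 by lra.
split.
- move=> k; apply/eqP; rewrite -sqrf_eq0; move: szE.
  rewrite psumr_eq0; last by move=> *; exact: sqr_ge0.
  by move=> /allP/(_ k (mem_index_enum _))/implyP/(_ isT).
- move=> c; move: syE; rewrite mulf_eq0 gt_eqF//= psumr_eq0//.
  move=> /allP/(_ c (mem_index_enum _))/implyP/(_ isT).
  by rewrite subr_eq0 => /eqP.
- move=> i j ij; move: sxE; rewrite psumr_eq0//; last first.
    by move=> *; exact: sumr_ge0.
  move=> /allP/(_ i (mem_index_enum _))/implyP/(_ isT).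
  rewrite psumr_eq0// => /allP/(_ j (mem_index_enum _))/implyP/(_ isT).
  by rewrite /x ij subr_eq0 => /eqP.
Qed.

(** * The Gram matrix of the regular simplex *)

Lemma simplex_ETFE i j : simplex_ETF R C i j =
  Num.sqrt a * ((i == j)%:R - C%:R^-1).
Proof. by rewrite /simplex_ETF !mxE mulr1. Qed.

Lemma simplex_ETF_tr : (simplex_ETF R C)^T = simplex_ETF R C.
Proof. by apply/matrixP => i j; rewrite mxE !simplex_ETFE eq_sym. Qed.

Lemma const_mx1_sqr :
  const_mx 1 *m (const_mx 1 : 'M[R]_C) = C%:R *: const_mx 1 :> 'M[R]_C.
Proof.
apply/matrixP => i j; rewrite !mxE mulr1.
under eq_bigr do rewrite !mxE mulr1.
by rewrite sumr_const card_ord.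
Qed.

(** The orthogonal projection onto the hyperplane orthogonal to the all-ones vector. *)
Let J : 'M[R]_C := 1%:M - C%:R^-1 *: const_mx 1.

Let JJ : J *m J = J.
Proof.
rewrite {1}/J mulmxBl mul1mx -scalemxAl /J mulmxBr mulmx1 -scalemxAr.
rewrite const_mx1_sqr scalerA mulVf ?scale1r ?subrr ?scaler0 ?subr0//.
by rewrite gt_eqF// (lt_trans ltr01).
Qed.

Lemma simplex_ETF_gram :
  (simplex_ETF R C)^T *m simplex_ETF R C = a *: J.
Proof.
rewrite simplex_ETF_tr /simplex_ETF -/J -scalemxAl -scalemxAr JJ scalerA.
by rewrite -expr2 sqr_sqrtr// ltW.
Qed.

Lemma gram_diag i : (a *: J) i i = 1.
Proof.
rewrite !mxE eqxx mulr1 /a /=; field.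
by rewrite ?subr_eq0 ?gt_eqF// ?(lt_trans ltr01).
Qed.

(** The value is -1/(C-1), written in terms of [a] so that it combines with [coldist2E]. *)
Lemma gram_offdiag i j : i != j -> (a *: J) i j = 1 - a.
Proof.
move=> /negbTE ij; rewrite !mxE ij mulr1 /a /=; field.
by rewrite ?subr_eq0 ?gt_eqF// ?(lt_trans ltr01).
Qed.

(** By polarization, the norms and distances fixed in the equality case determine all inner
    products. *)
Lemma extremal_gram M : (forall c, colnorm2 M c <= 1) ->
  (forall i j, i != j -> 2 * a <= coldist2 M i j) -> M^T *m M = a *: J.
Proof.
move=> M1 Ma; have [_ Mn Md] := coldist2_extremal _ M1 Ma.
apply/matrixP => i j; have [<-|ij] := eqVneq i j.
  by rewrite gram_diag -colnorm2_gram.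
rewrite gram_offdiag//; have := Md i j ij.
by rewrite coldist2E !Mn; lra.
Qed.

(** Divided by the square root of [a], [M] is isometric on the range of [J] and kills the all-ones
    vector [e]; it remains to send [e] isometrically to the orthogonal complement of the columns. *)
Lemma gram_simplex_orthogonal M : (forall k, \sum_i M k i = 0) ->
  M^T *m M = a *: J ->
  exists2 U, orthogonal_mx U & M = U *m simplex_ETF R C.
Proof.
move=> Ms MG; pose e : 'cV[R]_C := const_mx 1.
have Me : M *m e = 0.
  apply/matrixP => i j; rewrite !mxE.
  by under eq_bigr do rewrite mxE mulr1; exact: Ms.
have eeT : e *m e^T = const_mx 1.
  by apply/matrixP => i j; rewrite !mxE big_ord1 !mxE mulr1.
have C0 : 0 < C%:R :> R by exact: lt_trans ltr01 CgtR1.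
(* Since [M] kills [e] it is singular, so it also has a nonzero left kernel vector: a direction
   orthogonal to every column. *)
have /det0P [v v0 vM] : \det M == 0.
  rewrite -det_tr; apply/det0P; exists e^T.
    apply/eqP => /matrixP/(_ ord0 (Ordinal (ltnW C2))).
    by rewrite !mxE => /eqP; rewrite oner_eq0.
  by rewrite -trmx_mul Me trmx0.
pose n : R := (v *m v^T) 0 0.
have n0 : 0 < n.
  have nE : n = \sum_j v 0 j ^+ 2.
    by rewrite /n mxE; apply: eq_bigr => j _; rewrite mxE expr2.
  rewrite lt_neqAle eq_sym nE sumr_ge0 ?andbT; last by move=> *; exact: sqr_ge0.
  apply: contra v0; rewrite psumr_eq0; last by move=> *; exact: sqr_ge0.
  move=> /allP v0; apply/eqP/matrixP => i j; rewrite ord1 mxE; apply/eqP.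
  by have := v0 j (mem_index_enum _) => /implyP/(_ isT); rewrite sqrf_eq0.
have vv : v *m v^T = n%:M.
  by apply/matrixP => i j; rewrite !ord1 [RHS]mxE eqxx mulr1n.
have a0 : Num.sqrt a != 0 by rewrite gt_eqF// sqrtr_gt0.
(* [t] divides by the norms of [v] and [e], so that the rank-one term restores exactly the part of
   the identity missing from [J]. *)
pose t := (Num.sqrt n * Num.sqrt C%:R)^-1.
have tt : t * t * n = C%:R^-1.
  rewrite /t -invfM -expr2 exprMn !sqr_sqrtr ?ltW// invfM mulrAC mulVf ?mul1r//.
  by rewrite gt_eqF.
have aa : (Num.sqrt a)^-1 * (Num.sqrt a)^-1 * a = 1.
  by rewrite -invfM -expr2 sqr_sqrtr ?ltW// mulVf// gt_eqF.
have MTv : M^T *m v^T = 0 by rewrite -trmx_mul vM trmx0.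
have eJ : e^T *m J = 0.
  have eTc : e^T *m const_mx 1 = C%:R *: e^T.
    apply/matrixP => i j; rewrite !mxE mulr1.
    under eq_bigr do rewrite !mxE mulr1.
    by rewrite sumr_const card_ord.
  rewrite /J mulmxBr mulmx1 -scalemxAr eTc scalerA mulVf ?scale1r ?subrr//.
  by rewrite gt_eqF.
have Mc : M *m (const_mx 1 : 'M[R]_C) = 0 by rewrite -eeT mulmxA Me mul0mx.
(* The missing direction of the regular simplex is filled by a unit vector
   orthogonal to all columns of [M]. *)
exists ((Num.sqrt a)^-1 *: M + t *: (v^T *m e^T)).
  rewrite /orthogonal_mx.
  have -> : ((Num.sqrt a)^-1 *: M + t *: (v^T *m e^T))^T =
      (Num.sqrt a)^-1 *: M^T + t *: (e *m v).
    by rewrite linearD/= !linearZ/= trmx_mul !trmxK.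
  rewrite mulmxDl !mulmxDr -!scalemxAl -!scalemxAr MG.
  have -> : M^T *m (v^T *m e^T) = 0 by rewrite mulmxA MTv mul0mx.
  have -> : e *m v *m M = 0 by rewrite -mulmxA vM mulmx0.
  have -> : e *m v *m (v^T *m e^T) = n *: const_mx 1.
    by rewrite mulmxA -(mulmxA e) vv mul_mx_scalar -scalemxAl eeT.
  rewrite !scaler0 addr0 add0r !scalerA aa tt scale1r /J.
  by rewrite subrK.
(* The rank-one term disappears because [e^T *m J = 0], and [M *m J = M] because [M] kills
   constants. *)
rewrite /simplex_ETF -/J -scalemxAr mulmxDl -!scalemxAl -mulmxA eJ mulmx0.
rewrite scaler0 addr0 scalerA mulfV// scale1r /J mulmxBr mulmx1 -scalemxAr Mc.
by rewrite scaler0 subr0.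
Qed.

Lemma orthogonal_simplex_gram U : orthogonal_mx U ->
  (U *m simplex_ETF R C)^T *m (U *m simplex_ETF R C) = a *: J.
Proof.
move=> UU; rewrite trmx_mul mulmxA -(mulmxA _ U^T) UU mulmx1.
exact: simplex_ETF_gram.
Qed.

End column_geometry.
Arguments coldist2 {R C} M i j.

(** * Error exponents *)

(** The interval has length one, and the density on it is at least its value at distance [K] from
    the origin. *)
Lemma normal_prob_unit_itv_ge (R : realType) (u K : R) :
  (forall x : R, u <= x <= u + 1 -> `|x| <= K) ->
  ((normal_peak 1 * expR (- (K ^+ 2 / 2)))%:E <=
   normal_prob 0 1 `[u, (u + 1)%R]%classic)%E.
Proof.
move=> uK; rewrite /normal_prob.
set c := normal_peak 1 * _.
have c0 : 0 <= c by rewrite mulr_ge0 ?normal_peak_ge0 ?expR_ge0.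
apply: (@le_trans _ _
    (\int[lebesgue_measure]_(x in `[u, (u + 1)%R]%classic) (cst c%:E) x)%E).
  rewrite integral_cst//= lebesgue_measure_itv/= lte_fin ltrDl ltr01.
  by rewrite -EFinD addrAC subrr add0r mule1.
apply: ge0_le_integral => //.
- by apply/measurable_funTS/measurable_EFinP; exact: measurable_normal_pdf.
- move=> x /=; rewrite in_itv/= => /uK xK.
  rewrite lee_fin normal_pdfE ?oner_eq0// /c ler_wpM2l ?normal_peak_ge0//.
  rewrite ler_expR subr0 expr1n mulNr lerN2 ler_pM2r ?invr_gt0//.
  by rewrite -real_normK ?num_real// lerXn2r ?nnegrE ?(le_trans _ xK).
Qed.

Lemma measurable_set_ge0 (R : realType) (d : measure_display)
    (T : measurableType d) (f : T -> R) :
  measurable_fun setT f -> measurable [set t | 0 <= f t].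
Proof.
move=> mf; have -> : [set t | 0 <= f t] = f @^-1` `[0, +oo[%classic.
  by apply/seteqP; split => t /=; rewrite in_itv/= andbT.
by rewrite -[_ @^-1` _]setTI; apply: mf.
Qed.

Lemma content_le_sum (R : realType) (d : measure_display)
    (T : measurableType d) (mu : {measure set T -> \bar R}) (I : finType)
    (A : set T) (F : I -> set T) :
  measurable A -> (forall i, measurable (F i)) ->
  A `<=` [set t | exists i, F i t] -> (mu A <= \sum_i mu (F i))%E.
Proof.
move=> mA mF AF.
rewrite -[leRHS]big_enum/= fsbig_seq ?enum_uniq//.
apply: content_sub_fsum => //.
move=> t /AF [i Ft]; exists i => //=.
by rewrite mem_enum.
Qed.

Lemma lee_prod (R : realDomainType) (I : Type) (r : seq I) (f g : I -> \bar R) :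
  (forall i, 0 <= f i)%E -> (forall i, f i <= g i)%E ->
  (\prod_(i <- r) f i <= \prod_(i <- r) g i)%E.
Proof.
move=> f0 fg; suff /andP[] : (0 <= \prod_(i <- r) f i <= \prod_(i <- r) g i)%E.
  by [].
elim/big_rec2 : _ => [|i x y _ /andP[x0 xy]]; first by rewrite lee01 lexx.
by rewrite mule_ge0// lee_pmul.
Qed.

(** Both bounds on the normalised logarithm will be quadratics in [s] whose constant term is the
    exponent. *)
Lemma quadratic_cvg0 (R : realType) (a b c : R) :
  a * s ^+ 2 + b * s + c @[s --> 0^'+] --> c.
Proof.
apply: cvg_at_right_filter.
rewrite -[X in _ --> X]add0r -[X in _ --> X + c](_ : a * 0 ^+ 2 + b * 0 = 0);
  last by rewrite expr0n !mulr0 addr0.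
apply: cvgD; last exact: cvg_cst.
apply: cvgD.
  by apply: cvgM; [exact: cvg_cst|exact: sqr_continuous].
by apply: cvgM; [exact: cvg_cst|exact: cvg_id].
Qed.

(** * Upper and lower bounds on the error probability *)

Section error_exponent.
Context (R : realType) (d : measure_display) (T : measurableType d)
  (P : probability T R) (C : nat) (Z : 'I_C -> T -> R).
Hypothesis hZ : iid_std_gaussian P Z.
Implicit Types (M W : 'M[R]_C) (b : 'cV[R]_C) (s : R) (g c i j : 'I_C).

Let mZ i : measurable_fun setT (Z i). Proof. by case: hZ. Qed.

(* The half-space at distance [|v| / s] from the origin contains a product of
   unit intervals whose closest corner has the same norm [|v| / s]. *)
Lemma gaussian_halfspace_ge (w v : 'I_C -> R) s : 0 < s ->
  ((\prod_(k < C) (normal_peak 1 * expR (- ((`|v k| / s + 1) ^+ 2 / 2))))%:E <=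
   P [set t | 0 <= \sum_(k < C) w k * (s * Z k t - v k)]%R)%E.
Proof.
move=> s0.
(* The side of each interval follows the sign of [w k], which makes every term of the linear form
   nonnegative on the box. *)
pose u k := if 0 <= w k then `|v k| / s else - (`|v k| / s) - 1.
pose A k : set R := `[u k, (u k + 1)]%classic.
have q0 k : 0 <= `|v k| / s by rewrite divr_ge0// ltW.
have mA k : measurable (A k) by exact: measurable_itv.
apply: (@le_trans _ _ (P (\bigcap_(k in [set: 'I_C]) Z k @^-1` A k))); last first.
  apply: le_measure; rewrite ?inE.
  - apply: fin_bigcap_measurable => // i _.
    by rewrite -[_ @^-1` _]setTI; exact: mZ.
  - apply: measurable_set_ge0; apply: measurable_sum => k.
    by apply: measurable_funM => //; apply: measurable_funB => //;
      exact: measurable_funM.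
  - move=> t /= At; apply: sumr_ge0 => k _; have := At k I.
    rewrite /A /u /= in_itv/=; case: ifP => [w0 /andP[+ _]|/negbT + /andP[_]].
      rewrite ler_pdivrMr// mulrC => vZ; rewrite mulr_ge0// subr_ge0.
      by rewrite (le_trans (ler_norm _)).
    rewrite -ltNge subrK -mulNr ler_pdivlMr// mulrC => w0 vZ.
    rewrite mulr_le0 ?(ltW w0)// subr_le0 (le_trans vZ)//.
    by rewrite lerNl -normrN ler_norm.
rewrite (iid_gaussian_bigcap _ _ _ _ _ _ hZ _ mA) -prodEFin.
apply: lee_prod => k.
  by rewrite lee_fin mulr_ge0 ?normal_peak_ge0 ?expR_ge0.
apply: normal_prob_unit_itv_ge => x.
rewrite /u; case: ifP => _ /andP[ux xu].
  by rewrite ger0_norm// (le_trans _ ux).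
by rewrite ler_norml; have := q0 k; lra.
Qed.

Lemma scoreE M W b s g c t :
  score W b (col g M + s *: \col_k Z k t) c =
  \sum_(k < C) W c k * (M k g + s * Z k t) + b c ord0.
Proof. by congr (_ + _); apply: eq_bigr => k _; rewrite !mxE. Qed.

Lemma measurable_score_le M W b s g c :
  measurable [set t | score W b (col g M + s *: \col_k Z k t) g
    <= score W b (col g M + s *: \col_k Z k t) c].
Proof.
have mscore c' : measurable_fun setT
    (fun t => \sum_(k < C) W c' k * (M k g + s * Z k t) + b c' ord0).
  apply: measurable_funD => //; apply: measurable_sum => k.
  apply: measurable_funM => //; apply: measurable_funD => //.
  exact: measurable_funM.
have := measurable_set_ge0 _ _ _ _ (measurable_funB (mscore c) (mscore g)).
by congr measurable; apply/seteqP; split => t /=; rewrite !scoreE subr_ge0.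
Qed.

Lemma measurable_misclassified M W b s g :
  measurable (misclassified Z M W b s g).
Proof.
have -> : misclassified Z M W b s g =
    \bigcup_(c in [set c | c != g])
      [set t | score W b (col g M + s *: \col_k Z k t) g
        <= score W b (col g M + s *: \col_k Z k t) c].
  by apply/seteqP; split => t [c]; exists c.
apply: fin_bigcup_measurable; first exact: finite_finset.
move=> c _; exact: measurable_score_le.
Qed.

Lemma error_prob_ge M W b s g (x : R) :
  (x%:E <= P (misclassified Z M W b s g))%E ->
  C%:R^-1 * x <= error_prob P Z M W b s.
Proof.
move=> xP; rewrite /error_prob ler_wpM2l ?invr_ge0//.
rewrite (bigD1 g)//= -[leLHS]addr0 lerD//.
  rewrite -lee_fin fineK// fin_num_measure//; exact: measurable_misclassified.
by apply: sumr_ge0 => k _; rewrite fine_ge0.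
Qed.

Lemma error_prob_pair_ge M W b s i j : 0 < s -> i != j ->
  C%:R^-1 * \prod_(k < C)
    (normal_peak 1 * expR (- ((`|(M k j - M k i) / 2| / s + 1) ^+ 2 / 2)))
  <= error_prob P Z M W b s.
Proof.
move=> s0 ij.
(* Depending on its side of the decision boundary, the midpoint of [mu_i] and
   [mu_j] is misclassified for [i] or for [j]. *)
pose q := \sum_(k < C) (W j k - W i k) * ((M k i + M k j) / 2)
  + (b j ord0 - b i ord0).
have [q0|q0] := leP 0 q.
- apply: (error_prob_ge _ _ _ _ i).
  (* From class [i] the observation is the midpoint plus [s] times the noise minus half of
     [mu_j - mu_i], so the score difference is the linear form plus [q]. *)
  apply: le_trans (gaussian_halfspace_ge (fun k => W j k - W i k) _ _ s0) _.
  apply: le_measure; rewrite ?inE.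
  + apply: measurable_set_ge0; apply: measurable_sum => k.
    by apply: measurable_funM => //; apply: measurable_funB => //;
      exact: measurable_funM.
  + exact: measurable_misclassified.
  move=> t /= H; exists j; first by rewrite eq_sym.
  rewrite -subr_ge0 !scoreE; apply: le_trans (addr_ge0 H q0) _.
  rewrite le_eqVlt; apply/orP; left; apply/eqP.
  rewrite /q [LHS]addrA -big_split [in RHS]opprD [RHS]addrACA -sumrB.
  by congr (_ + _); apply: eq_bigr => k _ /=; field.
- apply: (error_prob_ge _ _ _ _ j).
  under eq_bigr do rewrite -normrN.
  apply: le_trans (gaussian_halfspace_ge (fun k => W i k - W j k) _ _ s0) _.
  apply: le_measure; rewrite ?inE.
  + apply: measurable_set_ge0; apply: measurable_sum => k.
    by apply: measurable_funM => //; apply: measurable_funB => //;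
      exact: measurable_funM.
  + exact: measurable_misclassified.
  move=> t /= H; exists i => //.
  rewrite -subr_ge0 !scoreE; move: q0; rewrite -oppr_gt0 => /ltW q0.
  apply: le_trans (addr_ge0 H q0) _.
  rewrite le_eqVlt; apply/orP; left; apply/eqP.
  rewrite /q opprD -sumrN [LHS]addrA -big_split [in RHS]opprD [RHS]addrACA -sumrB.
  congr (_ + _); last by ring.
  by apply: eq_bigr => k _ /=; field.
Qed.

Let pk : R := normal_peak 1.

Let pk0 : 0 < pk. Proof. by rewrite normal_peak_gt0 ?oner_eq0. Qed.

Lemma error_prob_gt0 M W b s i j : 0 < s -> i != j ->
  0 < error_prob P Z M W b s.
Proof.
move=> s0 ij; apply: lt_le_trans (error_prob_pair_ge M W b s i j s0 ij).
rewrite mulr_gt0 ?invr_gt0 ?ltr0n ?(leq_ltn_trans _ (ltn_ord i))//.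
by apply: prodr_gt0 => k _; rewrite mulr_gt0 ?expR_gt0.
Qed.

(** Multiplying by [s ^+ 2] turns each [(v k / s + 1) ^+ 2] into [(v k + s) ^+ 2]; the prefactors
    and the unit width of the intervals only affect the terms that vanish with [s]. *)
Lemma exponent_le_quadratic M W b i j : i != j -> exists A B : R,
  forall s, 0 < s -> - (s ^+ 2 * ln (error_prob P Z M W b s)) <=
    A * s ^+ 2 + B * s + coldist2 M i j / 8.
Proof.
move=> ij; pose v k := `|(M k j - M k i) / 2|.
exists (ln C%:R - ln pk *+ C + \sum_(k < C) 2^-1), (\sum_(k < C) v k) => s s0.
have C0 : 0 < C%:R :> R by rewrite ltr0n (leq_ltn_trans _ (ltn_ord i)).
pose x := C%:R^-1 * (pk ^+ C * expR (- \sum_(k < C) ((v k / s + 1) ^+ 2 / 2))).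
have xE : C%:R^-1 * \prod_(k < C)
    (normal_peak 1 * expR (- ((v k / s + 1) ^+ 2 / 2))) = x.
  rewrite big_split/= prodr_const card_ord -expR_sum.
  by congr (_ * (_ * expR _)); rewrite sumrN.
have x0 : 0 < x.
  apply: mulr_gt0; first by rewrite invr_gt0.
  by apply: mulr_gt0; rewrite ?expR_gt0 ?exprn_gt0.
have lnx : ln x <= ln (error_prob P Z M W b s).
  rewrite ler_ln ?posrE ?(error_prob_gt0 _ _ _ _ i j)//.
  by rewrite -xE; exact: error_prob_pair_ge.
apply: (@le_trans _ _ (- (s ^+ 2 * ln x))).
  by rewrite lerN2 ler_wpM2l// sqr_ge0.
rewrite /x lnM ?posrE ?invr_gt0//; last by rewrite mulr_gt0 ?expR_gt0 ?exprn_gt0.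
rewrite lnM ?posrE ?expR_gt0 ?exprn_gt0// lnV ?posrE// lnXn// expRK.
have -> : coldist2 M i j / 8 = \sum_(k < C) v k ^+ 2 / 2.
  rewrite /coldist2 mulr_suml; apply: eq_bigr => k _.
  by rewrite /v real_normK ?num_real//; field.
have sE : s ^+ 2 * (\sum_(k < C) (v k / s + 1) ^+ 2 / 2) =
    (\sum_(k < C) 2^-1) * s ^+ 2 + (\sum_(k < C) v k) * s
    + \sum_(k < C) v k ^+ 2 / 2.
  rewrite mulr_sumr !mulr_suml -!big_split/=; apply: eq_bigr => k _; field.
  by rewrite gt_eqF.
have lin (p q r : R) : - (s ^+ 2 * (- p + (q - r))) =
    s ^+ 2 * (p - q) + s ^+ 2 * r by ring.
rewrite lin sE le_eqVlt; apply/orP; left; apply/eqP; ring.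
Qed.

Lemma exponent_le_coldist2 M W b beta i j : i != j ->
  has_error_exponent P Z M W b beta -> 8 * beta <= coldist2 M i j.
Proof.
move=> ij Mbeta; have [A [B AB]] := exponent_le_quadratic M W b i j ij.
rewrite mulrC -ler_pdivlMr//.
apply: (ler_cvg_to Mbeta (quadratic_cvg0 R A B _)).
by near=> s; exact: AB.
Unshelve. all: by end_near. Qed.

(** For the matched filter, confusing [g] with [c] means that the noise, paired with [mu_c - mu_g],
    reaches [a / s]. This vector has squared norm [2 * a], so Chernoff's exponent is
    [a / (4 * s ^+ 2)]; the union bound costs a factor [C]. *)
Lemma error_prob_gram_le M (a s : R) : 0 < a -> 0 < s ->
  (forall i j, i != j -> (M^T *m M) i j = (M^T *m M) j j - a) ->
  (forall i j, i != j -> coldist2 M i j = 2 * a) ->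
  error_prob P Z M M^T 0 s <= C%:R * expR (- (a / (4 * s ^+ 2))).
Proof.
move=> a0 s0 Mg Md; set y := expR _.
have hs g c : c != g ->
    (P [set t | score M^T 0 (col g M + s *: \col_k Z k t) g
      <= score M^T 0 (col g M + s *: \col_k Z k t) c]%R <= y%:E)%E.
  move=> cg; have MD := Md c g cg.
  have -> : [set t | score M^T 0 (col g M + s *: \col_k Z k t) g
      <= score M^T 0 (col g M + s *: \col_k Z k t) c] =
      [set t | a / s <= \sum_(k < C) (M k c - M k g) * Z k t].
    apply: eq_set => t; rewrite !scoreE -subr_ge0 ler_pdivrMr//.
    rewrite -[X in _ = is_true X]subr_ge0.
    congr (is_true (0 <= _)); rewrite !mxE !addr0 -sumrB.
    have -> : a = (M^T *m M) g g - (M^T *m M) c g by rewrite (Mg c g cg); ring.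
    rewrite opprB addrC !mxE -sumrB mulr_suml -big_split/=.
    by apply: eq_bigr => k _; rewrite !mxE; ring.
  have := gaussian_halfspace_le _ _ _ _ _ _ hZ (fun k => M k c - M k g) (a / s).
  rewrite -/(coldist2 M c g) MD => hle.
  apply: (le_trans (hle _ _)); first by rewrite divr_ge0 ?ltW.
    by rewrite mulr_gt0.
  rewrite lee_fin /y ler_expR lerN2.
  rewrite le_eqVlt; apply/orP; left; apply/eqP; field.
  by rewrite !gt_eqF.
have hg g : fine (P (misclassified Z M M^T 0 s g)) <= C%:R * y.
  rewrite -lee_fin fineK; last first.
    by rewrite fin_num_measure//; exact: measurable_misclassified.
  (* For [c = g] the score comparison always holds, so the true class gets the empty event
     instead. *)
  pose F c := if c == g then set0 else
    [set t | score M^T 0 (col g M + s *: \col_k Z k t) g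
      <= score M^T 0 (col g M + s *: \col_k Z k t) c].
  apply: (@le_trans _ _ (\sum_c P (F c))%E).
    apply: content_le_sum; first exact: measurable_misclassified.
      by move=> c; rewrite /F; case: ifP => // _; exact: measurable_score_le.
    by move=> t [c /negbTE cg H]; exists c; rewrite /F cg.
  apply: (@le_trans _ _ (\sum_(c < C) y%:E)%E).
    apply: lee_sum => c _; rewrite /F; case: ifPn => [_|cg]; last exact: hs.
    by rewrite measure0 lee_fin expR_ge0.
  by rewrite sumEFin sumr_const card_ord mulr_natl.
rewrite /error_prob; have [C0|C0] := posnP C.
  by subst C; rewrite big_ord0 mulr0 mul0r.
rewrite ler_pdivrMl ?ltr0n//.
apply: le_trans (ler_sum _ (fun g _ => hg g)) _.
by rewrite sumr_const card_ord -[leLHS]mulr_natl.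
Qed.

(** Squeeze: the union bound loses only [s ^+ 2 * ln C%:R], and the pair [i0], [j0] at squared
    distance [2 * a] gives the matching upper bound [2 * a / 8]. *)
Lemma gram_error_exponent M (a : R) i0 j0 : i0 != j0 -> 0 < a ->
  (forall i j, i != j -> (M^T *m M) i j = (M^T *m M) j j - a) ->
  (forall i j, i != j -> coldist2 M i j = 2 * a) ->
  has_error_exponent P Z M M^T 0 (a / 4).
Proof.
move=> ij a0 Mg Md.
have [A [B AB]] := exponent_le_quadratic M M^T 0 i0 j0 ij.
have C0 : 0 < C%:R :> R by rewrite ltr0n (leq_ltn_trans _ (ltn_ord i0)).
apply: (squeeze_cvgr _ (quadratic_cvg0 R (- ln C%:R) 0 _)
  (quadratic_cvg0 R A B _)).
near=> s; have s0 : 0 < s by near: s; exact: nbhs_right_gt.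
apply/andP; split; last first.
  by have := AB s s0; rewrite Md//; congr (_ <= _ + _); field.
have := error_prob_gram_le M a s a0 s0 Mg Md.
have e0 := error_prob_gt0 M M^T 0 s i0 j0 s0 ij.
rewrite -ler_ln ?posrE//; last by rewrite mulr_gt0 ?expR_gt0.
rewrite lnM ?posrE ?expR_gt0// expRK => H.
have := ler_wpM2l (ltW (exprn_gt0 2 s0)) H.
have -> : s ^+ 2 * (ln C%:R - a / (4 * s ^+ 2)) = s ^+ 2 * ln C%:R - a / 4.
  by field; rewrite gt_eqF.
by lra.
Unshelve. all: by end_near. Qed.

End error_exponent.

(** The decision matrix is the transpose of the signal matrix, and an orthogonal [U] leaves the Gram
    matrix unchanged. Both attainment claims of the theorem follow, with [U = 1] for the first. *)
Lemma simplex_error_exponent (R : realType) (d : measure_display)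
    (T : measurableType d) (P : probability T R) (C : nat) (Z : 'I_C -> T -> R)
    (U : 'M[R]_C) :
  (2 <= C)%N -> iid_std_gaussian P Z -> orthogonal_mx U ->
  has_error_exponent P Z (U *m simplex_ETF R C) (simplex_ETF R C *m U^T) 0
    (beta_star R C).
Proof.
move=> C2 hZ UU.
have a0 : 0 < C%:R / (C%:R - 1) :> R.
  by rewrite divr_gt0 ?subr_gt0 ?ltr1n// ltr0n (leq_trans _ C2).
have -> : simplex_ETF R C *m U^T = (U *m simplex_ETF R C)^T.
  by rewrite trmx_mul simplex_ETF_tr.
have G := orthogonal_simplex_gram R C C2 U UU.
pose i0 := Ordinal (ltnW C2); pose j0 := Ordinal C2.
have ij0 : i0 != j0 by [].
apply: (gram_error_exponent _ _ _ _ _ _ hZ _ _ i0 j0) => // i j ij.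
  by rewrite G gram_offdiag// gram_diag.
by rewrite coldist2E !colnorm2_gram G !gram_diag// gram_offdiag//; ring.
Qed.

Theorem theorem5 (R : realType) (d : measure_display) (T : measurableType d)
  (P : probability T R) (C : nat) (Z : 'I_C -> T -> R) :
  (2 <= C)%N -> iid_std_gaussian P Z ->
  [/\ (* beta_star is an upper bound on all achievable error exponents *)
      (forall (M W : 'M[R]_C) (b : 'cV[R]_C) (beta : R),
         (forall c, colnorm2 M c <= 1) ->
         has_error_exponent P Z M W b beta -> beta <= beta_star R C),
      (* it is attained by (M*, M*, 0) *)
      has_error_exponent P Z (simplex_ETF R C) (simplex_ETF R C) 0 (beta_star R C),
      (* every optimal M is a rotation of M* *)
      (forall (M W : 'M[R]_C) (b : 'cV[R]_C),
         (forall c, colnorm2 M c <= 1) ->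
         has_error_exponent P Z M W b (beta_star R C) ->
         exists2 U : 'M[R]_C, orthogonal_mx U & M = U *m simplex_ETF R C) &
      (* and for M = U M*, (W, b) = (M* U^T, 0) is optimal *)
      (forall U : 'M[R]_C, orthogonal_mx U ->
         has_error_exponent P Z (U *m simplex_ETF R C)
           (simplex_ETF R C *m U^T) 0 (beta_star R C))].
Proof.
move=> C2 hZ; split.
- move=> M W b beta M1 Mbeta.
  have : 8 * beta <= 2 * (C%:R / (C%:R - 1)).
    apply: (coldist2_min_le _ _ C2 _ _ M1) => i j ij.
    exact: exponent_le_coldist2 hZ _ _ _ _ _ _ ij Mbeta.
  by rewrite /beta_star; lra.
- have := simplex_error_exponent _ _ _ _ _ _ 1%:M C2 hZ.
  by rewrite /orthogonal_mx trmx1 !mulmx1 mul1mx; apply.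
- move=> M W b M1 Mbeta.
  have Md i j : i != j -> 2 * (C%:R / (C%:R - 1)) <= coldist2 M i j.
    move=> ij; have := exponent_le_coldist2 _ _ _ _ _ _ hZ _ _ _ _ _ _ ij Mbeta.
    by rewrite /beta_star; lra.
  (* Besides the Gram matrix, the construction of [U] uses that equality forces the columns to sum
     to zero. *)
  have [Ms _ _] := coldist2_extremal _ _ C2 _ M1 Md.
  apply: (gram_simplex_orthogonal _ _ C2) => //.
  exact: extremal_gram.
- by move=> U; exact: simplex_error_exponent.
Qed.
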